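(* Let $M$ be a non-trivial module over the Lie algebra $W_1$ such that $M=\mathbb{C}[L_{-1}]v$ is free of rank one as a $\mathbb{C}[L_{-1}]$-module. Then there exist a polynomial $q\in\mathbb{C}[x]$ and $a\in\mathbb{C}$ such that the action of $W_1$ on $M$ is $$L_j.\,L_{-1}^nv=\sum_{k=0}^{j+1}\binom{n}{k}\frac{(j+1)!}{(j+1-k)!}L_{-1}^{n-k}\Big((j+1-k)B_{j-k}\big(q'(L_{-1}),q''(L_{-1}),\ldots,q^{(j-k)}(L_{-1})\big)\,a\,v+B_{j+1-k}\big(q'(L_{-1}),q''(L_{-1}),\ldots,q^{(j+1-k)}(L_{-1})\big)L_{-1}v\Big)$$ for all integers $j\ge-1$ and $n\ge0$.
   Context: $W_1=\bigoplus_{i\ge-1}\mathbb{C}L_i$ is the complex Lie algebra with bracket $[L_i,L_j]=(i-j)L_{i+j}$ for all integers $i,j\ge-1$. $B_n$ is the $n$-th (complete) Bell polynomial $$B_n(x_1,\ldots,x_n)=\sum_{p_1+2p_2+\cdots+np_n=n}\frac{n!}{p_1!p_2!\cdots p_n!}\Big(\frac{x_1}{1!}\Big)^{p_1}\Big(\frac{x_2}{2!}\Big)^{p_2}\cdots\Big(\frac{x_n}{n!}\Big)^{p_n},$$ with $B_0=1$. Conventions: a term with $k>n$ is zero (since $\binom nk=0$), and the summand $(j+1-k)B_{j-k}(\cdots)av$ is zero when $k=j+1$. *)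

(* Defs.v *)
From HB Require Import structures.
From mathcomp Require Import all_boot all_order all_algebra.
From mathcomp Require Import ring.
From mathcomp Require Import reals complex.

Set Implicit Arguments.
Unset Strict Implicit.
Unset Printing Implicit Defensive.

Import Order.TTheory GRing.Theory Num.Theory.
Local Open Scope ring_scope.

HB.mixin Record Lmodule_isLie (K : comNzRingType) V of GRing.Lmodule K V := {
  lieb : V -> V -> V;
  lieb_linearl : forall y : V, linear (lieb^~ y);
  lieb_linearr : forall x : V, linear (lieb x);
  liebxx : forall x : V, lieb x x = 0;
  lieb_jacobi : forall x y z : V,
    lieb x (lieb y z) + lieb y (lieb z x) + lieb z (lieb x y) = 0
}.

#[short(type="lieAlgType")]
HB.structure Definition LieAlgebra (K : comNzRingType) :=
  { V of Lmodule_isLie K V & GRing.Lmodule K V }.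

Record lie_module (K : comNzRingType) (g : lieAlgType K) (M : lmodType K)
    (act : g -> M -> M) : Prop := LieModule {
  act_linearl : forall m : M, linear (act^~ m);
  act_linearr : forall x : g, linear (act x);
  act_lieb : forall (x y : g) (m : M),
    act (lieb x y) m = act x (act y m) - act y (act x m)
}.

Definition nontrivial_action (K : comNzRingType) (g : lieAlgType K)
    (M : lmodType K) (act : g -> M -> M) : Prop :=
  exists x m, act x m <> 0.

(* The direct sum of the lines K L_i, i >= -1: the coefficient of L_i is the
   coefficient of 'X^(i + 1). *)
Definition W1 (K : comNzRingType) : Type := {poly K}.

HB.instance Definition _ (K : comNzRingType) :=
  GRing.Lmodule.on (W1 K).

(* Only meaningful for -1 <= i. *)
Definition W1L (K : comNzRingType) (i : int) : W1 K := 'X^(absz (i + 1)).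

(* Bilinear extension of [L_i, L_j] = (i - j) L_(i + j), with both indices
   shifted by 1. The truncated predecessor only matters for i = j = 0, where
   the coefficient vanishes. *)
Definition W1_bracket (K : comNzRingType) (f g : W1 K) : W1 K :=
  \sum_(i < size (f : {poly K})) \sum_(j < size (g : {poly K}))
    ((f : {poly K})`_i * (g : {poly K})`_j * (i%:R - j%:R))
      *: ('X^((i + j).-1) : {poly K}).

Section W1Theory.
Variable K : comNzRingType.
Implicit Types f g h : {poly K}.

Lemma W1_bracketE f g : W1_bracket f g = f^`() * g - f * g^`() :> {poly K}.
Proof.
have E (p : {poly K}) : p = \sum_(i < size p) p`_i *: 'X^i.
  by rewrite -poly_def coefK.
have D (p : {poly K}) : p^`() = \sum_(i < size p) p`_i *: ('X^(i.-1) *+ i).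
  rewrite {1}(E p) raddf_sum; apply: eq_bigr => i _ /=.
  by rewrite linearZ /= derivXn.
transitivity ((\sum_(i < size f) f`_i *: ('X^(i.-1) *+ i))
      * (\sum_(j < size g) g`_j *: 'X^j)
    - (\sum_(i < size f) f`_i *: 'X^i)
      * (\sum_(j < size g) g`_j *: ('X^(j.-1) *+ j))); last by rewrite -!D -!E.
rewrite /W1_bracket !mulr_suml -sumrB.
apply: eq_bigr => i _; rewrite !mulr_sumr -sumrB; apply: eq_bigr => j _.
rewrite -!scaler_nat -!scalerAl -!scalerAr.
rewrite -!exprD !scalerA mulrBr scalerBl.
congr (_ - _).
- rewrite (mulrAC f`_i).
  by case: (nat_of_ord i) => [|m]; rewrite ?mulr0 ?mul0r ?scale0r.
- rewrite !mulrA.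
  by case: (nat_of_ord j) => [|m]; rewrite ?mulr0 ?scale0r // !addnS.
Qed.

Fact W1_linearl (g : W1 K) : linear ((@W1_bracket K)^~ g).
Proof.
move=> a x y; rewrite !W1_bracketE derivD derivZ.
by rewrite scalerBr !mulrDl !scalerAl opprD addrACA.
Qed.

Fact W1_linearr (f : W1 K) : linear (W1_bracket f).
Proof.
move=> a x y; rewrite !W1_bracketE derivD derivZ.
by rewrite scalerBr !mulrDr !scalerAr opprD addrACA.
Qed.

Fact W1_bracketxx (f : W1 K) : W1_bracket f f = 0.
Proof. by rewrite W1_bracketE mulrC subrr. Qed.

Fact W1_jacobi (f g h : W1 K) :
  W1_bracket f (W1_bracket g h) + W1_bracket g (W1_bracket h f)
    + W1_bracket h (W1_bracket f g) = 0.
Proof. by rewrite !W1_bracketE !derivB !derivM; ring. Qed.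

HB.instance Definition _ := Lmodule_isLie.Build K (W1 K)
  W1_linearl W1_linearr W1_bracketxx W1_jacobi.

Lemma W1_lieb (i j : int) : (-1 <= i)%R -> (-1 <= j)%R ->
  lieb (W1L K i) (W1L K j) = (i - j)%:~R *: W1L K (i + j).
Proof.
have E (k : int) : (-1 <= k)%R -> exists m : nat, k = m%:Z - 1.
  by move=> hk; exists (absz (k + 1)); rewrite gez0_abs ?addrK // -lerBlDr sub0r.
move=> /E[m ->] /E[n ->].
have -> : lieb (W1L K (m%:Z - 1)) (W1L K (n%:Z - 1))
    = W1_bracket (W1L K (m%:Z - 1)) (W1L K (n%:Z - 1)) by [].
rewrite W1_bracketE /W1L !subrK !absz_nat !derivXn mulrnAl mulrnAr -!exprD.
have -> : m%:Z - 1 - (n%:Z - 1) = m%:Z - n%:Z by ring.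
have -> : m%:Z - 1 + (n%:Z - 1) + 1 = (m + n)%N%:Z - 1 by rewrite PoszD; ring.
have [/eqP|mn_gt0] := posnP (m + n)%N.
  by rewrite addn_eq0 => /andP[/eqP-> /eqP->]; rewrite !mulr0n !subrr scale0r.
have -> : absz ((m + n)%N%:Z - 1) = (m + n).-1.
  by case: (m + n)%N mn_gt0 => // k _; rewrite -addn1 PoszD addrK addn1.
rewrite rmorphB /= -!pmulrn scalerBl !scaler_nat; congr (_ - _).
  by case: m {mn_gt0} => [|m]; rewrite ?mulr0n.
by case: n {mn_gt0} => [|n]; rewrite ?mulr0n // addnS.
Qed.

End W1Theory.

(* [bell x n] is B_n(x_1, ..., x_n); x is indexed from 1, so that [x 0] is
   unused. Each p_i is at most n because i p_i <= n. *)
Definition bell (K : fieldType) (A : comAlgType K) (x : nat -> A) (n : nat) : A :=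
  \sum_(p : {ffun 'I_n -> 'I_n.+1} | (\sum_(i < n) i.+1 * p i)%N == n)
    (n`!%:R / \prod_(i < n) (p i)`!%:R : K)
      *: \prod_(i < n) (i.+1`!%:R^-1 *: x i.+1) ^+ p i.

(* p(T) m, for an endomorphism T *)
Definition poly_act (K : comNzRingType) (M : lmodType K) (T : M -> M)
    (p : {poly K}) (m : M) : M :=
  \sum_(i < size p) p`_i *: iter i T m.

(* M = K[T] v, free of rank one over K[T] with basis v *)
Definition free_rank_one_on (K : comNzRingType) (M : lmodType K) (T : M -> M)
    (v : M) : Prop :=
  forall m : M, exists! p : {poly K}, poly_act T p v = m.

Lemma bell0 (K : fieldType) (A : comAlgType K) (x : nat -> A) : bell x 0 = 1.
Proof.
rewrite /bell (bigD1 [ffun=> ord0]) ?big_ord0 //= big1.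
  by rewrite fact0 divr1 scale1r addr0.
by move=> p /andP[_ /eqP[]]; apply/ffunP => -[].
Qed.

(* Main.v *)
(* Identify M with K[x], where x = L_(-1), and put P_m = L_(m-1) 1. Since
   [L_(m-1), x] = m L_(m-2), the polynomials P_m determine the action:
   L_(m-1) p = sum_k C(m,k) p^(k) P_(m-k). The relation [L_0, L_(m-1)] = (1-m) L_(m-1)
   applied to 1 reads
     x P_m' + (m-1) P_m = sum_(k >= 1) C(m,k) P_1^(k) P_(m-k),
   and x d/dx + (m-1) is injective for m >= 2, so that P_1 determines all P_m.
   Write P_1 = a + x q'. The family m a B_(m-1) + x B_m solves the same recursion,
   because applying the derivation x d/dx + t d/dt to
   sum_m B_m t^m / m! = exp (sum_(k >= 1) q^(k) t^k / k!) yields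
     x B_m' + m B_m = sum_(k >= 1) C(m,k) (x q^(k+1) + k q^(k)) B_(m-k). *)
From HB Require Import structures.
Require Import Defs.
From mathcomp Require Import all_boot all_order all_algebra.
From mathcomp Require Import reals complex.
From mathcomp Require Import ring zify.

Set Implicit Arguments.
Unset Strict Implicit.
Unset Printing Implicit Defensive.

Import Order.TTheory GRing.Theory Num.Theory.
Local Open Scope ring_scope.
Local Open Scope complex_scope.

(** * Polynomials compared up to a given degree *)

Section CoefficientsUpTo.
Variable A : comNzRingType.
Implicit Types u w : {poly A}.

Definition eq_upto n u w := forall k, (k <= n)%N -> u`_k = w`_k.

Lemma eq_upto_mul n u u' w w' :
  eq_upto n u u' -> eq_upto n w w' -> eq_upto n (u * w) (u' * w').
Proof.
move=> hu hw k kn; rewrite !coefM; apply: eq_bigr => i _.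
by have ik := ltn_ord i; rewrite hu ?hw //; lia.
Qed.

Lemma eq_upto_prod n (I : Type) (r : seq I) (P : pred I) (F G : I -> {poly A}) :
  (forall i, P i -> eq_upto n (F i) (G i)) ->
  eq_upto n (\prod_(i <- r | P i) F i) (\prod_(i <- r | P i) G i).
Proof.
move=> FG; elim/big_ind2: _ => // [x1 x2 y1 y2]; exact: eq_upto_mul.
Qed.

Lemma eq_upto_addMXn n m u w : (n < m)%N -> eq_upto n (u + w * 'X^m) u.
Proof. by move=> nm k kn; rewrite coefD coefMXn (leq_ltn_trans kn nm) addr0. Qed.

End CoefficientsUpTo.

(** * Truncated exponentials and the Euler derivation *)

Section TruncatedExponential.
Variable K : numFieldType.
Local Notation A := {poly K}.
Implicit Types (u w : {poly A}).

(* The variable of the outer polynomials is t, that of [A] is x. *)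
Definition texp N u : {poly A} := \sum_(p < N.+1) (p`!%:R^-1 : K)%:P%:P * u ^+ p.

(** The derivation D = t d/dt + x d/dx of K[x][t]; the second summand applies x d/dx to each
    coefficient. *)
Definition euler u : {poly A} :=
  'X * u^`() + \poly_(i < size u) ('X * (u`_i)^`()).

Lemma coef_euler u i : (euler u)`_i = 'X * (u`_i)^`() + u`_i *+ i.
Proof.
rewrite coefD coefXM coef_deriv coef_poly addrC.
congr (_ + _); last by case: i.
by case: ltnP => // /(nth_default 0) ->; rewrite deriv0 mulr0.
Qed.

Lemma euler_is_additive : additive euler.
Proof.
move=> u w; apply/polyP => i; rewrite coefB !coef_euler coefB derivB; ring.
Qed.
HB.instance Definition _ := GRing.isZmodMorphism.Build _ _ euler euler_is_additive.

Lemma eulerM u w : euler (u * w) = euler u * w + u * euler w.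
Proof.
apply/polyP => n; rewrite coef_euler coefD !coefM raddf_sum /=.
rewrite mulr_sumr -sumrMnl -!big_split /=; apply: eq_bigr => i _.
rewrite !coef_euler derivM.
have -> : (u`_i * w`_(n - i)) *+ n
    = (u`_i * w`_(n - i)) *+ i + (u`_i * w`_(n - i)) *+ (n - i).
  by rewrite -mulrnDr subnKC // -ltnS.
ring.
Qed.

Lemma euler_const (c : K) : euler c%:P%:P = 0.
Proof.
apply/polyP => n; rewrite coef_euler coefC coef0.
by case: n => [|n]; rewrite /= ?derivC ?deriv0 ?mulr0 ?mul0rn ?addr0.
Qed.

Lemma euler1 : euler 1 = 0.
Proof. exact: (euler_const 1). Qed.

Lemma euler_exp u n : euler (u ^+ n) = (euler u * u ^+ n.-1) *+ n.
Proof.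
elim: n => [|[|n] IH]; first by rewrite euler1.
  by rewrite mulr1.
rewrite exprS eulerM IH /= mulrnAr [in RHS]mulrS; congr (_ + _ *+ _).
by rewrite exprS; ring.
Qed.

Lemma euler_prod (I : finType) (F : I -> {poly A}) :
  euler (\prod_i F i) = \sum_i euler (F i) * \prod_(j | j != i) F j.
Proof.
(* The induction runs over duplicate-free lists, where j != i leaves out exactly one factor. *)
have E (r : seq I) : uniq r -> euler (\prod_(i <- r) F i) =
    \sum_(i <- r) euler (F i) * \prod_(j <- r | j != i) F j.
  elim: r => [|i r IH] /=; first by rewrite !big_nil euler1.
  case/andP=> ir ur; rewrite !big_cons eulerM IH // eqxx /=; congr (_ * _ + _).
    rewrite [RHS]big_seq_cond [LHS]big_seq; apply: eq_bigl => j.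
    by case: eqVneq => [->|]; rewrite ?(negPf ir) ?andbT.
  rewrite mulr_sumr; apply: eq_big_seq => j jr; rewrite big_cons.
  have -> : i != j by apply: contraNneq ir => ->.
  by ring.
by rewrite E // index_enum_uniq.
Qed.

Lemma texpS N u :
  texp N.+1 u = texp N u + (N.+1`!%:R^-1 : K)%:P%:P * u ^+ N.+1.
Proof. by rewrite /texp big_ord_recr. Qed.

Lemma texp0 u : texp 0 u = 1.
Proof. by rewrite /texp big_ord1 invr1 mul1r. Qed.

(** The truncated form of D exp(u) = D(u) exp(u). It is exact because D(u^p / p!) = D(u) u^(p-1) /
    (p-1)! lowers the order by one. *)
Lemma euler_texp N u : euler (texp N.+1 u) = euler u * texp N u.
Proof.
elim: N => [|N IH].
  by rewrite texpS !texp0 raddfD /= euler1 invr1 mul1r expr1 add0r mulr1.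
rewrite texpS raddfD /= IH [in RHS]texpS mulrDr eulerM euler_const mul0r add0r.
congr (_ + _); rewrite euler_exp /= mulrnAr -mulrnAl mulrCA; congr (_ * (_ * _)).
rewrite -!polyCMn; congr (_%:P%:P); rewrite [N.+2`!]factS natrM invfM.
by rewrite -[LHS]mulr_natl mulrA mulfV ?mul1r // pnatr_eq0.
Qed.

(** Divisibility of the argument by t keeps the terms of order above n out of the degrees up to
    n. *)
Lemma texp_upto n N u : (n <= N)%N ->
  eq_upto n (texp N (u * 'X)) (texp n (u * 'X)).
Proof.
elim: N => [|N IH]; first by rewrite leqn0 => /eqP->.
rewrite leq_eqVlt => /orP[/eqP-> //|nN] k kn.
by rewrite texpS exprMn mulrA (eq_upto_addMXn _ _ nN) // IH.
Qed.

Lemma texp_upto1 n N m u : (n < m)%N -> eq_upto n (texp N (u * 'X^m)) 1.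
Proof.
move=> nm; elim: N => [|N IH] k kn; first by rewrite texp0.
rewrite texpS exprS !mulrA [_ * 'X^m * _]mulrAC.
by rewrite (eq_upto_addMXn _ _ nm) // IH.
Qed.

(** * The generating function of the Bell polynomials *)

Variable x : nat -> A.

Definition bell_arg i : {poly A} := ((i.+1`!%:R^-1 : K) *: x i.+1) *: 'X^(i.+1).

(* Agrees with the exponential generating function of the [bell x n] up to t^N. *)
Definition bell_gf N : {poly A} := \prod_(i < N) texp N (bell_arg i).

Lemma bell_argE i :
  bell_arg i = (((i.+1`!%:R^-1 : K) *: x i.+1) *: 'X^i) * 'X.
Proof. by rewrite /bell_arg exprSr scalerAl. Qed.

Lemma bell_gf_upto n N : (n <= N)%N -> eq_upto n (bell_gf N) (bell_gf n).
Proof.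
move=> nN k kn; transitivity (\prod_(i < N) texp n (bell_arg i))`_k.
  apply: (eq_upto_prod (n := n)) kn => i _; rewrite bell_argE.
  exact: texp_upto.
(* The factors of index at least n are 1 modulo t^(n+1). *)
rewrite -(big_mkord xpredT (fun i => texp n (bell_arg i))).
rewrite (big_cat_nat (n := n)) //= big_mkord -[bell_gf n]mulr1.
apply: (eq_upto_mul (n := n)) kn => //; rewrite big_nat_cond.
elim/big_ind: _ => // [u w hu hw|i /andP[/andP[ni _] _]].
  by rewrite -[1]mulr1; apply: eq_upto_mul.
by rewrite /bell_arg -mul_polyC; apply: texp_upto1.
Qed.

(** Expanding the product chooses the term of order p_i in factor i. The t-degree is then the sum of
    the (i+1) p_i, and truncating at n gives exactly the functions p over which [bell] ranges. *)
Lemma coef_bell_gf n : (bell_gf n)`_n = (n`!%:R^-1 : K) *: bell x n.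
Proof.
rewrite /bell_gf /texp bigA_distr_bigA /= coef_sum /bell scaler_sumr.
rewrite [RHS]big_mkcond; apply: eq_bigr => p _.
have -> : \prod_(i < n) (((p i)`!%:R^-1 : K)%:P%:P * bell_arg i ^+ p i) =
    ((\prod_(i < n) (p i)`!%:R^-1 : K)%:P
      * \prod_(i < n) (i.+1`!%:R^-1 *: x i.+1) ^+ p i)%:P
      * 'X^(\sum_(i < n) i.+1 * p i)%N.
  rewrite rmorphM /= !rmorph_prod /= -prodrXr -!big_split /=.
  apply: eq_bigr => i _; rewrite exprM -mulrA; congr (_ * _).
  by rewrite rmorphXn /= -exprMn mul_polyC.
rewrite coefCM coefXn eq_sym; case: eqP => _; rewrite ?mulr0 // mulr1.
rewrite mul_polyC scalerA mulrA mulVf ?mul1r ?prodfV //.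
by rewrite pnatr_eq0 -lt0n fact_gt0.
Qed.

Lemma euler_bell_arg i : euler (bell_arg i) =
  ((i.+1`!%:R^-1 : K) *: ('X * (x i.+1)^`() + x i.+1 *+ i.+1)) *: 'X^(i.+1).
Proof.
apply/polyP => n; rewrite coef_euler !coefZ !coefXn.
have [->|_] := eqVneq; last by rewrite !mulr0 deriv0 mulr0 mul0rn addr0.
by rewrite !mulr1 derivZ -scalerAr scalerMnr scalerDr.
Qed.

(** The coefficient of t^m in D exp(S) = D(S) exp(S), where S is the sum of the x_k t^k / k!. *)
Lemma bell_euler m : 'X * (bell x m)^`() + bell x m *+ m =
  \sum_(i < m) ('X * (x i.+1)^`() + x i.+1 *+ i.+1) * bell x (m - i.+1)
     *+ 'C(m, i.+1).
Proof.
have f0 k : (k`!%:R : K) != 0 by rewrite pnatr_eq0 -lt0n fact_gt0.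
have: (euler (bell_gf m.+1))`_m = \sum_(i < m)
    ((i.+1`!%:R^-1 : K) *: ('X * (x i.+1)^`() + x i.+1 *+ i.+1))
      * (bell_gf (m - i.+1))`_(m - i.+1).
  (* The summand of index m is a multiple of t^(m+1), hence contributes nothing. *)
  rewrite euler_prod coef_sum big_ord_recr /= addrC euler_texp euler_bell_arg.
  rewrite -!scalerAl -!mulrA coefZ coefXnM ltnSn mulr0 add0r.
  apply: eq_bigr => i _; rewrite euler_texp euler_bell_arg.
  rewrite -!scalerAl -!mulrA coefZ coefXnM ltnNge ltn_ord /=.
  rewrite [RHS]scalerAl; congr (_ * _).
  (* Factor i now has order m instead of m+1, which does not affect the coefficients up to t^m. *)
  rewrite -(@bell_gf_upto (m - i.+1) m.+1) //; last by lia.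
  rewrite /bell_gf [in RHS](bigD1 (widen_ord (leqnSn m) i)) //=.
  apply: (eq_upto_mul (n := m) _ _ (leq_subr _ _)) => // k km.
  by rewrite bell_argE (texp_upto _ (leqnSn m)).
rewrite coef_euler (bell_gf_upto (leqnSn m)) // coef_bell_gf.
rewrite derivZ -scalerAr scalerMnr -scalerDr.
move=> /(congr1 ( *:%R (m`!%:R : K))).
rewrite scalerA divff // scale1r => ->; rewrite scaler_sumr.
apply: eq_bigr => i _; rewrite coef_bell_gf -scalerAl -scalerAr !scalerA.
rewrite -[RHS](@scaler_nat K); congr (_ *: _).
rewrite -(bin_fact (ltn_ord i)) natrM (natrM _ i.+1`!) -mulrA -invfM.
by rewrite mulfK ?mulf_neq0.
Qed.

End TruncatedExponential.

(** * Operators on K[x] satisfying the relations of W_1 *)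

Section PolynomialModel.
Variable K : numFieldType.
Implicit Types p q : {poly K}.

(** The operator multiplies the coefficient of x^i by i + n, which is nonzero in characteristic
    zero. *)
Lemma euler_shift_inj n p : (0 < n)%N -> 'X * p^`() + p *+ n = 0 -> p = 0.
Proof.
move=> n0 /polyP h; apply/polyP => i; move: (h i).
rewrite coefD coefXM coefMn coef_deriv coef0.
have -> : (if i == 0%N then 0 else p`_i.-1.+1 *+ i.-1.+1) = p`_i *+ i by case: i.
move=> /eqP; rewrite -mulrnDr mulrn_eq0 addn_eq0.
by rewrite (gtn_eqF n0) andbF => /eqP.
Qed.

(* At [i = 0] the division by zero gives 0. *)
Definition primitive p : {poly K} := \poly_(i < size p) (p`_i / i%:R).

(** Supplies q and a in P_1 = a + x q': [primitive p] is an antiderivative of (p - p(0)) / x, not of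
    p. *)
Lemma primitiveK p : p = (primitive p)^`() * 'X + (p`_0)%:P.
Proof.
apply/polyP => i; rewrite coefD coefMX coefC coef_deriv coef_poly.
case: i => [|i] /=; rewrite ?add0r // addr0.
case: ltnP => [_|/(nth_default 0) -> //]; last by rewrite mul0rn.
by rewrite -[RHS]mulr_natr divfK ?pnatr_eq0.
Qed.

(** Both sides have the same image under x d/dx + 1, by [bell_euler] at m = 1. *)
Lemma bell1 (x : nat -> {poly K}) : bell x 1 = x 1%N.
Proof.
apply/subr0_eq/(@euler_shift_inj 1) => //.
have := bell_euler x 1; rewrite big_ord1 subnn bell0 mulr1 binn.
by rewrite derivB mulrBr mulrnBl addrACA -opprD => ->; rewrite subrr.
Qed.

(* [F m] is the action of L_(m-1). *)
Variable F : nat -> {poly K} -> {poly K}.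
Hypothesis F_linear : forall m, linear (F m).
Hypothesis F0 : forall p, F 0 p = 'X * p.
Hypothesis F_bracket : forall i j p,
  F i (F j p) - F j (F i p) = (i%:R - j%:R) *: F (i + j).-1 p.

HB.instance Definition _ m :=
  GRing.isLinear.Build K {poly K} {poly K} _ (F m) (F_linear m).

Lemma model_mulX m p : F m (p * 'X) = F m p * 'X + F m.-1 p *+ m.
Proof.
have := F_bracket m 0 p; rewrite !F0 addn0 subr0 scaler_nat => <-.
by rewrite ['X * p]mulrC ['X * _]mulrC addrC subrK.
Qed.

Lemma model_leibniz m p :
  F m p = \sum_(k < m.+1) p^`(k) * F (m - k) 1 *+ 'C(m, k).
Proof.
elim/poly_ind: p m => [|p c IH] [|m].
- by rewrite big_ord1 linear0 mul0r.
- by rewrite linear0 big1 // => k _; rewrite linear0 mul0r mul0rn.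
- by rewrite big_ord1 !F0 mulr1 mulrC.
have -> : F m.+1 (p * 'X + c%:P) = F m.+1 p * 'X + F m p *+ m.+1 + c%:P * F m.+1 1.
  by rewrite -alg_polyC linearD linearZ /= model_mulX -[c *: F _ _]mul_polyC alg_polyC.
rewrite !IH big_ord_recl [RHS]big_ord_recl !subn0 !bin0 !mulr1n !derivn0.
under [in RHS]eq_bigr => k _ do
  rewrite lift0 derivnMXaddC mulrDl mulrnDl subSS -[_ *+ k.+1]mulr_natr.
rewrite big_split /= mulrDl mulr_suml -sumrMnl.
(* By (m+1) C(m,i) = (i+1) C(m+1,i+1), these are the terms (i+1) p^(i) in the derivative of order
   i+1 of p x. *)
have -> : \sum_(i < m.+1) p^`(i) * F (m - i) 1 *+ 'C(m, i) *+ m.+1 =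
    \sum_(i < m.+1) p^`(i) * i.+1%:R * F (m - i) 1 *+ 'C(m.+1, i.+1).
  apply: eq_bigr => i _; rewrite mulr_natr mulrnAl -!mulrnA [(i.+1 * _)%N]mulnC.
  by rewrite [('C(m, i) * _)%N]mulnC (mul_bin_diag m.+1) mulnC.
rewrite [X in _ + X + _ + _](_ : _ = \sum_(i < m.+1)
  p^`(i.+1) * 'X * F (m - i) 1 *+ 'C(m.+1, i.+1)); first by ring.
by apply: eq_bigr => i _; rewrite mulrnAl mulrAC.
Qed.

Lemma model_euler m : 'X * (F m 1)^`() + F m 1 *+ m =
  F m 1 + \sum_(i < m) (F 1 1)^`(i.+1) * F (m - i.+1) 1 *+ 'C(m, i.+1).
Proof.
have := F_bracket 1 m 1; rewrite (model_leibniz 1) (model_leibniz m (F 1 1)).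
rewrite !big_ord_recl big_ord0 !subn0 !bin0 binn !mulr1n !derivn0 F0 mulr1 addr0.
(* The terms k = 0 of the two Leibniz expansions are both P_1 P_m and cancel. *)
rewrite [F 1 1 * _]mulrC ['X * _]mulrC => /eqP; rewrite opprD addrACA subrr add0r.
rewrite scalerBl scale1r scaler_nat subr_eq => /eqP ->.
by rewrite addrAC subrK addrC.
Qed.

Lemma model_bell : exists q a, forall m,
  F m 1 = a%:P * bell (fun i => q^`(i)) m.-1 *+ m + bell (fun i => q^`(i)) m * 'X.
Proof.
pose q := primitive (F 1 1); pose a := (F 1 1)`_0.
exists q, a => m; set B := bell (fun i => q^`(i)).
have F11 : F 1 1 = q^`() * 'X + a%:P by exact: primitiveK.
have B0 : B 0 = 1 by exact: bell0.
have Beuler n : 'X * (B n)^`() + B n *+ n =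
    \sum_(i < n) (F 1 1)^`(i.+1) * B (n - i.+1)%N *+ 'C(n, i.+1).
  (* By Leibniz, x q^(i+2) + (i+1) q^(i+1) is the derivative of order i+1 of x q' + a. *)
  rewrite bell_euler; apply: eq_bigr => i _; congr (_ * _ *+ _).
  by rewrite F11 derivnMXaddC -!derivSn -derivnS addrC mulrC.
(* Injectivity requires the shift m-1 to be positive, so m = 0 and m = 1 are treated directly. *)
elim/ltn_ind: m => -[|[|m]] IH.
- by rewrite B0 F0 mulr0n add0r mulrC.
- by rewrite /B bell0 bell1 F11 mulr1 addrC.
apply/subr0_eq/(@euler_shift_inj m.+1) => //.
rewrite derivB mulrBr mulrnBl addrACA -opprD; apply/eqP; rewrite subr_eq0.
have -> : 'X * (F m.+2 1)^`() + F m.+2 1 *+ m.+1 =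
    \sum_(i < m.+2) (F 1 1)^`(i.+1) * F (m.+2 - i.+1) 1 *+ 'C(m.+2, i.+1).
  by apply: (addrI (F m.+2 1)); rewrite -model_euler addrCA -mulrS.
(* The summand i = m+1 contains P_0 = x and enters only the second Bell sum, through B_0 = 1; the
   induction hypothesis covers the others. *)
have -> : \sum_(i < m.+2) (F 1 1)^`(i.+1) * F (m.+2 - i.+1) 1 *+ 'C(m.+2, i.+1) =
    a%:P * ('X * (B m.+1)^`() + B m.+1 *+ m.+1) *+ m.+2
    + ('X * (B m.+2)^`() + B m.+2 *+ m.+2) * 'X.
  rewrite !Beuler mulr_suml mulr_sumr -sumrMnl big_ord_recr /= subnn F0 mulr1.
  rewrite [X in _ = _ + X]big_ord_recr /= subnn B0 mulr1 binn !mulr1n addrA; congr (_ + _).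
  rewrite -big_split /=; apply: eq_bigr => i _.
  have im := ltn_ord i.
  rewrite (IH (m.+2 - i.+1)%N); last by lia.
  rewrite mulrDr mulrnDl subSS; congr (_ + _); last by rewrite mulrA mulrnAl.
  rewrite !mulrnAr -!mulrnA mulrCA subSn //=.
  rewrite subSS; congr (_ *+ _).
  by rewrite [RHS]mulnC (mul_bin_down m.+2) subSS subSn.
(* The factor x raises the shift by one: x (B x)' + (m+1) B x = (x B' + (m+2) B) x. *)
rewrite derivD derivMn !derivM derivC derivX /= !mulrS; apply/eqP; ring.
Qed.

End PolynomialModel.

(** * Polynomials in an endomorphism of a module *)

Section PolyAct.
Variables (K : comNzRingType) (M : lmodType K) (T : M -> M).
Hypothesis T_linear : linear T.
Implicit Types p q : {poly K}.

HB.instance Definition _ := GRing.isLinear.Build K M M _ T T_linear.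

Lemma iterZ i c m : iter i T (c *: m) = c *: iter i T m.
Proof. by elim: i => //= i ->; rewrite linearZ. Qed.

Lemma poly_act_widen N p m : (size p <= N)%N ->
  poly_act T p m = \sum_(i < N) p`_i *: iter i T m.
Proof.
move=> pN; rewrite /poly_act (big_ord_widen N (fun i => p`_i *: iter i T m)) //.
rewrite big_mkcond; apply: eq_bigr => i _; case: ltnP => // ip.
by rewrite nth_default // scale0r.
Qed.

Lemma poly_act_linear m : linear (fun p => poly_act T p m).
Proof.
move=> c p q; pose N := maxn (size p) (size q).
have N1 : (size p <= N)%N by rewrite leq_maxl.
have N2 : (size q <= N)%N by rewrite leq_maxr.
have N3 : (size (c *: p + q)%R <= N)%N.
  by rewrite (leq_trans (size_polyD _ _)) // geq_max N2 (leq_trans (size_scale_leq _ _)).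
rewrite !(@poly_act_widen N) // scaler_sumr -big_split; apply: eq_bigr => i _.
by rewrite coefD coefZ scalerDl scalerA.
Qed.

Lemma poly_actZ p c m : poly_act T p (c *: m) = c *: poly_act T p m.
Proof.
rewrite /poly_act scaler_sumr; apply: eq_bigr => i _.
by rewrite iterZ !scalerA mulrC.
Qed.

Lemma poly_act_mulXr p m : poly_act T (p * 'X) m = poly_act T p (T m).
Proof.
rewrite (@poly_act_widen (size p).+1) ?(leq_trans (size_mul_leq _ _)) //; last first.
  by rewrite size_polyX addn2.
rewrite big_ord_recl coefMX scale0r add0r; apply: eq_bigr => i _.
by rewrite lift0 coefMX iterSr.
Qed.

Lemma poly_act_mulX p m : poly_act T (p * 'X) m = T (poly_act T p m).
Proof.
rewrite poly_act_mulXr /poly_act linear_sum; apply: eq_bigr => i _.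
by rewrite linearZ -iterS iterSr.
Qed.

Lemma poly_act1 m : poly_act T 1 m = m.
Proof. by rewrite /poly_act size_poly1 big_ord1 coef1 scale1r. Qed.

Lemma poly_act_mulXn p n m : poly_act T (p * 'X^n) m = iter n T (poly_act T p m).
Proof. by elim: n => [|n IH]; rewrite ?mulr1 // exprSr mulrA poly_act_mulX IH. Qed.

End PolyAct.

(** * Transfer from K[x] to the module *)

Lemma lieb_Xn (K : comNzRingType) (i j : nat) :
  lieb ('X^i : W1 K) ('X^j : W1 K) = (i%:R - j%:R) *: ('X^((i + j).-1) : W1 K).
Proof.
have -> : lieb ('X^i : W1 K) ('X^j : W1 K) = W1_bracket ('X^i) ('X^j) by [].
rewrite W1_bracketE !derivXn mulrnAl mulrnAr -!exprD scalerBl !scaler_nat.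
by case: i j => [|i] [|j]; rewrite ?mulr0n // !addnS.
Qed.

(** Freeness makes p -> p(T) v a bijection from K[x] to M, and the action pulled back along it
    satisfies the hypotheses of the polynomial model. *)
Lemma rank_one_action (K : numFieldType) (M : lmodType K)
    (act : W1 K -> M -> M) (v : M) (T := act ('X^0 : {poly K})) :
  lie_module act -> free_rank_one_on T v ->
  exists (q : {poly K}) (a : K), forall m n,
    act ('X^m : {poly K}) (iter n T v) =
    \sum_(0 <= k < m.+1)
      ('C(n, k)%:R * (m`!%:R / (m - k)`!%:R)) *:
      iter (n - k) T
        ((m - k)%:R *: poly_act T (bell (fun i => q^`(i)) (m - k).-1) (a *: v)
         + poly_act T (bell (fun i => q^`(i)) (m - k)) (T v)).
Proof.
move=> [actl actr act_br] free_v.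
have Tlin : linear T by exact: actr.
pose phi p := poly_act T p v.
have ex m : exists p, phi p == m by have [p [/eqP pm _]] := free_v m; exists p.
pose psi m := xchoose (ex m).
have psiK m : phi (psi m) = m by apply/eqP; exact: (xchooseP (ex m)).
have phi_inj : injective phi.
  by move=> p p' pp'; have [r [_ ur]] := free_v (phi p'); rewrite -(ur p) // -(ur p').
have phi_lin : linear phi by exact: poly_act_linear.
pose F m p := psi (act ('X^m : {poly K}) (phi p)).
have phiF m p : phi (F m p) = act ('X^m : {poly K}) (phi p) by exact: psiK.
pose phiL : {linear {poly K} -> M} := HB.pack phi (GRing.isLinear.Build _ _ _ _ phi phi_lin).
have F_lin m : linear (F m).
  by move=> c p p'; apply: phi_inj; rewrite phi_lin !phiF phi_lin actr.
have F0 p : F 0 p = 'X * p.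
  by apply: phi_inj; rewrite phiF mulrC /phi poly_act_mulX.
have F_br i j p : F i (F j p) - F j (F i p) = (i%:R - j%:R) *: F (i + j).-1 p.
  apply: phi_inj.
  have phiB x y : phi (x - y) = phi x - phi y by exact: (raddfB phiL).
  have phiZ c x : phi (c *: x) = c *: phi x by exact: (scalable_linear phi_lin).
  rewrite phiB phiZ !phiF -act_br lieb_Xn.
  exact: (scalable_linear (actl _)).
have [q [a qa]] := model_bell F_lin F0 F_br.
exists q, a => m n.
have -> : iter n T v = phi ('X^n).
  by rewrite -['X^n]mul1r /phi poly_act_mulXn // poly_act1.
rewrite -phiF (model_leibniz F_lin F0 F_br) big_mkord.
have -> (G : 'I_m.+1 -> {poly K}) : phi (\sum_i G i) = \sum_i phi (G i).
  exact: (raddf_sum phiL).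
apply: eq_bigr => k _; rewrite derivnXn qa.
(* For k > n the left side vanishes with the k-th derivative of x^n and the right side with C(n,k),
   so the truncation of n - k is harmless. *)
have [nk|kn] := ltnP n k.
  rewrite (bin_small nk) mul0r scale0r (ffact_small nk) mulr0n mul0r mul0rn.
  exact: (raddf0 phiL).
have km : (k <= m)%N by rewrite -ltnS.
have phiZ c x : phi (c *: x) = c *: phi x by exact: (scalable_linear phi_lin).
set B := bell (fun i => q^`(i)); transitivity (('C(n, k)%:R * (m`!%:R / (m - k)`!%:R)) *:
    phi (((m - k)%:R *: (a *: B (m - k)%N.-1) + B (m - k)%N * 'X) * 'X^(n - k))).
  rewrite -phiZ; congr phi.
  rewrite [in LHS]mulrnAl -mulrnA -[LHS](@scaler_nat K) mulrC.
  have -> : (n ^_ k * 'C(m, k))%:R = 'C(n, k)%:R * (m`!%:R / (m - k)`!%:R) :> K.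
    rewrite -(ffact_fact km) [in RHS]natrM mulfK ?pnatr_eq0 -?lt0n ?fact_gt0 //.
    by rewrite -natrM -!bin_ffact mulnAC -mulnA.
  by rewrite -[_ *+ (m - k)](@scaler_nat K) mul_polyC.
(* Back in M, x^(n-k) becomes an iterate of T, and the factor x next to B_(m-k) is absorbed into T
   v. *)
rewrite /phi poly_act_mulXn // poly_actZ // -poly_act_mulXr //.
by rewrite -!phiZ -[phi _ + _](raddfD phiL).
Qed.

Theorem theorem3p17 (R : realType) (M : lmodType R[i])
    (act : W1 R[i] -> M -> M) (v : M) :
  lie_module act ->
  nontrivial_action act ->
  free_rank_one_on (act (W1L R[i] (-1))) v ->
  exists (q : {poly R[i]}) (a : R[i]),
    forall (j : int) (n : nat), -1 <= j ->
      let T := act (W1L R[i] (-1)) in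
      let J := absz (j + 1) in
      act (W1L R[i] j) (iter n T v) =
      \sum_(0 <= k < J.+1)
        ('C(n, k)%:R * (J`!%:R / (J - k)`!%:R)) *:
        iter (n - k) T
          ((J - k)%:R *: poly_act T (bell (fun i => q^`(i)) (J - k).-1) (a *: v)
           + poly_act T (bell (fun i => q^`(i)) (J - k)) (T v)).
Proof.
move=> act_mod _ free_v; have [q [a qa]] := rank_one_action act_mod free_v.
by exists q, a => j n _ /=; rewrite -qa.
Qed.
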